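(* There exists an order embedding of $(\mathcal{P}(\omega)/\mathrm{Fin},\subseteq^* )$ into the Gamified Katětov order $\leq_{\mathrm{LT}}^{\mathsf{o}}$ on ideals over $\omega$; that is, there is an assignment of an ideal $\mathcal{I}_P$ on $\omega$ to each class $[P]\in\mathcal{P}(\omega)/\mathrm{Fin}$ such that for all $P,Q\subseteq\omega$: $P\subseteq^* Q$ if and only if $\mathcal{I}_P\leq_{\mathrm{LT}}^{\mathsf{o}}\mathcal{I}_Q$. In particular, the Gamified Katětov order contains a chain of length $\mathfrak{b}$, as well as an antichain (a family of pairwise $\leq_{\mathrm{LT}}^{\mathsf{o}}$-incomparable ideals) of size $\mathfrak{c}$.
   Context: **Upper sets, filters, ideals.** An upper set $\mathcal{U}\subseteq\mathcal{P}(\omega)$ is a family closed upward under $\subseteq$; a lower set is a family closed downward under $\subseteq$. A filter is an upper set closed under finite intersections; an ideal is a lower set closed under finite unions (ideals are not required to be proper: $\mathcal{P}(\omega)$ counts as an ideal). The dual upper set of a lower set $\mathcal{I}$ is $\mathcal{I}^*:=\{A\subseteq\omega : \omega\setminus A\in\mathcal{I}\}$. **Trees.** ${}^{<\omega}\omega$ is the set of finite strings of natural numbers, ${}^{\omega}\omega$ the set of infinite strings; $p\upharpoonright n$ is the prefix of $p$ of length $n$, and $\sigma^\frown n$ is $\sigma$ extended by the entry $n$. A tree is a set $T\subseteq{}^{<\omega}\omega$ containing the empty string and closed under initial segments; $[T]:=\{p\in{}^{\omega}\omega : p\upharpoonright n\in T\ \text{for all } n\}$. For an upper set $\mathcal{V}$,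 a tree $T$ is $\mathcal{V}$-branching if for every $\sigma\in T$ (including the root) $\{n\in\omega : \sigma^\frown n\in T\}\in\mathcal{V}$. **Partial continuous functions.** A partial continuous function $\Phi:\subseteq{}^{\omega}\omega\to\omega$ is one determined by a partial function $\varphi:\subseteq{}^{<\omega}\omega\to\omega$ that is coherent (if $\sigma,\tau\in\mathrm{dom}(\varphi)$ and $\sigma$ is a prefix of $\tau$ then $\varphi(\sigma)=\varphi(\tau)$), via: $p\in\mathrm{dom}(\Phi)$ and $\Phi(p)=c$ iff there is $n$ with $p\upharpoonright n\in\mathrm{dom}(\varphi)$ and $\varphi(p\upharpoonright n)=c$. **Gamified Katětov order.** For upper sets $\mathcal{U},\mathcal{V}\subseteq\mathcal{P}(\omega)$, write $\mathcal{U}\leq_{\mathrm{LT}}^{\mathsf{o}}\mathcal{V}$ iff there exists a partial continuous function $\Phi:\subseteq{}^{\omega}\omega\to\omega$ such that for every $A\in\mathcal{U}$ there is a $\mathcal{V}$-branching tree $T$ with $[T]\subseteq\mathrm{dom}(\Phi)$ and $\Phi(p)\in A$ for all $p\in[T]$. This is a preorder on upper sets. For lower sets (in particular ideals) $\mathcal{H},\mathcal{I}$, write $\mathcal{H}\leq_{\mathrm{LT}}^{\mathsf{o}}\mathcal{I}$ iff $\mathcal{H}^*\leq_{\mathrm{LT}}^{\mathsf{o}}\mathcal{I}^*$. **Other notation.** $P\subseteq^*Q$ means $|P\setminus Q|<\infty$. $\mathcal{P}(\omega)/\mathrm{Fin}$ is the powerset of $\omega$ modulo the ideal $\mathrm{Fin}$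 of finite sets, partially ordered by the relation induced by $\subseteq^*$. $\mathfrak{b}$ is the bounding number (the least size of a family of functions $\omega\to\omega$ unbounded under eventual domination) and $\mathfrak{c}=2^{\aleph_0}$. Chains and antichains in the preorder are understood up to the equivalence induced by $\leq_{\mathrm{LT}}^{\mathsf{o}}$. *)

(* Defs.v *)
(* MathComp / MathComp-Analysis (classical layer) *)
From HB Require Import structures.
From mathcomp Require Import all_boot.
From mathcomp Require Import generic_quotient.
From mathcomp Require Import boolp classical_sets functions cardinality wochoice.

Set Implicit Arguments.
Unset Strict Implicit.
Unset Printing Implicit Defensive.

Local Open Scope classical_set_scope.
Local Open Scope card_scope.
Local Open Scope quotient_scope.

Definition lower_set (H : set (set nat)) : Prop :=
  forall A B, A `<=` B -> H B -> H A.

(* [I set0] is closure under the empty union; ideals need not be proper, nor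
   contain the finite sets. *)
Definition is_ideal (I : set (set nat)) : Prop :=
  [/\ lower_set I, I set0 & forall A B, I A -> I B -> I (A `|` B)].

Definition dual_upper (H : set (set nat)) : set (set nat) :=
  [set A | H (~` A)].

(* The prefix of length n of p : nat -> nat is [mkseq p n]. *)
Definition is_tree (T : set (seq nat)) : Prop :=
  T [::] /\ forall s t, prefix s t -> T t -> T s.

Definition body (T : set (seq nat)) : set (nat -> nat) :=
  [set p | forall n, T (mkseq p n)].

Definition branching (V : set (set nat)) (T : set (seq nat)) : Prop :=
  forall s, T s -> V [set n | T (rcons s n)].

Definition coherent (phi : seq nat -> option nat) : Prop :=
  forall s t a b, prefix s t -> phi s = Some a -> phi t = Some b -> a = b.

(* Partial functions are option-valued, None meaning "undefined". *)
Definition partial_continuous (Phi : (nat -> nat) -> option nat) : Prop :=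
  exists2 phi : seq nat -> option nat, coherent phi &
    forall p c, Phi p = Some c <-> exists n, phi (mkseq p n) = Some c.

Definition gamified_le (U V : set (set nat)) : Prop :=
  exists2 Phi : (nat -> nat) -> option nat, partial_continuous Phi &
    forall A, U A ->
      exists T, [/\ is_tree T, branching V T &
        forall p, body T p -> exists2 c, Phi p = Some c & A c].

Definition gamified_ideal_le (H I : set (set nat)) : Prop :=
  gamified_le (dual_upper H) (dual_upper I).

Definition almost_subset (P Q : set nat) : Prop := finite_set (P `\` Q).

Definition fin_eqv : rel (set nat) :=
  fun P Q => `[< almost_subset P Q /\ almost_subset Q P >].

Lemma almost_subset_trans P Q S :
  almost_subset P Q -> almost_subset Q S -> almost_subset P S.
Proof.
move=> PQ QS; apply: (@sub_finite_set _ _ ((P `\` Q) `|` (Q `\` S))).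
  move=> n [Pn nSn]; have [Qn|nQn] := EM (Q n); first by right.
  by left.
by rewrite finite_setU.
Qed.

Lemma fin_eqv_refl : reflexive fin_eqv.
Proof.
by move=> P; apply/asboolP; rewrite /almost_subset setDv; split; exact: finite_set0.
Qed.

Lemma fin_eqv_sym : symmetric fin_eqv.
Proof. by move=> P Q; apply/asboolP/asboolP => -[]. Qed.

Lemma fin_eqv_trans : transitive fin_eqv.
Proof.
move=> Q P S /asboolP[PQ QP] /asboolP[QS SQ]; apply/asboolP.
by split; [exact: almost_subset_trans PQ QS | exact: almost_subset_trans SQ QP].
Qed.

Canonical fin_equiv_rel :=
  EquivRel fin_eqv fin_eqv_refl fin_eqv_sym fin_eqv_trans.

Definition powerset_mod_fin := {eq_quot fin_eqv}.

Definition fin_class (P : set nat) : powerset_mod_fin :=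
  \pi_{eq_quot fin_eqv} P.

Definition eventually_le (f g : nat -> nat) : Prop :=
  exists N, forall n, N <= n -> f n <= g n.

Definition unbounded_family (F : set (nat -> nat)) : Prop :=
  ~ exists g, forall f, F f -> eventually_le f g.

Definition has_card_b (W : Type) : Prop :=
  (exists2 F, unbounded_family F & [set: W] #= F) /\
  (forall F, unbounded_family F -> [set: W] #<= F).

(* b as an ordinal is the initial ordinal of its cardinality: a well-order (R is
   reflexive) all of whose proper initial segments are of smaller cardinality. *)
Definition order_type_b (W : Type) (R : rel W) : Prop :=
  [/\ well_order R, has_card_b W &
      forall x, ~~ ([set: W] #<= [set y | R y x /\ y <> x])].

(* Main.v *)
Require Import Defs.
From mathcomp Require Import all_boot.
From mathcomp Require Import generic_quotient.
From mathcomp Require Import boolp classical_sets functions cardinality wochoice.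
From mathcomp Require Import zify.

Local Open Scope classical_set_scope.
Local Open Scope card_scope.

(** The natural numbers are cut into consecutive finite blocks [X_n] of
    quickly growing length, and [I_P] consists of the sets that meet almost
    every [X_n], [n] outside [P], in at most [k * h n] points for some
    constant [k], where [h n = 2 ^ min X_n] ([thin_off]). Increasing [P]
    modulo a finite set increases [I_P], and a larger ideal is higher in the
    order, so only one direction of the embedding has content: if [E = P \
    Q] is infinite, then [I_P] is not below [I_Q]. Since [I_E] is contained
    in [I_P] and [I_Q] in [I_(~E)], it is enough that [I_E] is not below
    [I_(~E)] ([thin_off_not_le_setC]). Here the trees offer moves in the
    blocks with index in [E], whereas the answers have to avoid a set [Z]
    that may contain all these blocks but must be thin in the others.

    Given a partial continuous [Phi], the set [Z] is chosen so that every
    branching tree has a path on which [Phi] is undefined or answers in [Z].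
    A position [s] forces [y] when [Phi] answers [y] at [s] already, or
    positively many children of [s] force [y] ([forces]); then every
    branching tree through [s] has a path with answer [y] ([forces_body]).
    For each increasing [s] below [X_m], [m] outside [E], the set [Z] gets
    at most two points of [X_m]: one that [s] forces, and one that is forced
    by many of the children of [s] in some single block [X_n] with [m < n];
    [h m] counts the possible [s]. Let now a tree avoid [Z], and consider a
    position [s] in it that forces nothing. If all its children in the tree
    and in a far block [X_n] force something, what they force lies in
    earlier blocks, since [Z] has guessed an answer in any later block. The
    block [X_n] is so much longer than [n * h n] times the number of earlier
    points that some [y] in an earlier block [X_m] is forced by many of
    these children. As [n] grows, [m] tends to infinity, otherwise one [y]
    would be forced by positively many children of [s], hence by [s]. So [m]
    may be taken large, and then the second guess of [Z] for [s] and [m]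
    exists and is forced by a child of [s] in the tree, which is impossible.
    Hence positions that force nothing can be prolonged indefinitely, and
    [Phi] has no answer on the resulting path.

    The chain and the antichain come from [P(omega)/Fin]: regions below the
    graphs of functions [omega -> omega] turn eventual domination into
    almost inclusion, and a transfinite recursion of length [b] gives a
    strictly increasing sequence of functions, because fewer than [b]
    functions are always bounded; the branches of the binary tree form an
    almost disjoint family. *)

(** * Blocks and thin sets *)

(** The block [X_n] starts at [b = block_start n] and has
    [(b + 1) * (n * 2 ^ b) + 1] elements: one too many to be the union of
    [b + 1] sets with at most [n * 2 ^ b] elements. *)
Fixpoint block_start n :=
  if n is m.+1 then
    block_start m + ((block_start m).+1 * (m * 2 ^ block_start m)).+1
  else 0.

Definition in_block n x : bool := block_start n <= x < block_start n.+1.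

Definition block_count (A : set nat) n : nat :=
  count (fun x => `[< A x >]) (index_iota (block_start n) (block_start n.+1)).

(** The bound [2 ^ block_start n] is the number of strictly increasing sequences
    with entries below the block. *)
Definition thin_off (P A : set nat) : Prop :=
  exists k, forall n, k <= n -> ~ P n -> block_count A n <= k * 2 ^ block_start n.

Lemma block_startS n : block_start n.+1 =
  block_start n + ((block_start n).+1 * (n * 2 ^ block_start n)).+1.
Proof. by []. Qed.

Lemma leq_block_start m n : m <= n -> block_start m <= block_start n.
Proof.
elim: n => [|n IH]; first by rewrite leqn0 => /eqP ->.
rewrite leq_eqVlt => /predU1P[->//|/IH le_mn].
by rewrite block_startS (leq_trans le_mn) ?leq_addr.
Qed.

Lemma leq_block_startn n : n <= block_start n.
Proof. by elim: n => // n IH; rewrite block_startS; lia. Qed.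

Lemma in_block_ex x : exists n, in_block n x.
Proof.
have exn : exists n, x < block_start n.+1.
  by exists x; exact: leq_block_startn.
case: (ex_minnP exn) => -[|n] lt_x min_n; first by exists 0; rewrite /in_block lt_x.
exists n.+1; rewrite /in_block lt_x andbT leqNgt; apply/negP => lt_x'.
by have := min_n _ lt_x'; rewrite ltnn.
Qed.

Lemma in_block_lt m n x y : in_block m x -> in_block n y -> m < n -> x < y.
Proof.
move=> /andP[_ lt_x] /andP[le_y _] /leq_block_start le_mn.
by rewrite (leq_trans lt_x) ?(leq_trans le_mn).
Qed.

Lemma in_block_inj m n x : in_block m x -> in_block n x -> m = n.
Proof.
move=> mx nx; case: (ltngtP m n) => // [mn|nm].
  by have := in_block_lt _ _ _ _ mx nx mn; rewrite ltnn.
by have := in_block_lt _ _ _ _ nx mx nm; rewrite ltnn.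
Qed.

Lemma block_countS (A B : set nat) n :
  (forall x, in_block n x -> A x -> B x) -> block_count A n <= block_count B n.
Proof.
move=> AB; rewrite /block_count -(size_filter) -[leqRHS]size_filter.
apply: uniq_leq_size => [|x]; first exact/filter_uniq/iota_uniq.
rewrite !mem_filter mem_index_iota => /andP[/asboolP Ax nx].
by rewrite nx andbT; apply/asboolP/AB.
Qed.

Lemma block_count0 n : block_count set0 n = 0.
Proof.
rewrite /block_count (eq_count (a2 := pred0)) ?count_pred0 // => x.
by apply/asboolP.
Qed.

Lemma block_countU (A B : set nat) n :
  block_count (A `|` B) n <= block_count A n + block_count B n.
Proof.
rewrite /block_count -count_predUI; apply: leq_trans (leq_addr _ _).
by apply: sub_count => x /asboolP[] ?; apply/orP; [left|right]; apply/asboolP.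
Qed.

Lemma block_count_bigU k c (C : nat -> set nat) n :
  (forall y, y < k -> block_count (C y) n <= c) ->
  block_count [set x | exists2 y, y < k & C y x] n <= k * c.
Proof.
elim: k => [|k IH] le_c.
  apply: (@leq_trans (block_count set0 n)); last by rewrite block_count0.
  by apply: block_countS => x _ [].
have IHk := IH (fun y lt_y => le_c y (ltnW lt_y)).
rewrite mulSn; apply: leq_trans (leq_add (le_c k (ltnSn k)) IHk).
apply: leq_trans (block_countU _ _ _); apply: block_countS => x _ [y].
rewrite ltnS leq_eqVlt => /predU1P[->|lt_y] Cx; first by left.
by right; exists y.
Qed.

Lemma block_countT n : block_count setT n =
  ((block_start n).+1 * (n * 2 ^ block_start n)).+1.
Proof.
rewrite /block_count -size_filter (eq_filter (a2 := xpredT)); last first.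
  by move=> x; apply/asboolP.
by rewrite filter_predT size_iota block_startS addKn.
Qed.

Lemma block_count_gt0 A n : 0 < block_count A n -> exists2 x, in_block n x & A x.
Proof.
rewrite -has_count => /hasP[x]; rewrite mem_index_iota => nx /asboolP Ax.
by exists x.
Qed.

Lemma block_meet (A B : set nat) n c : block_count (~` A) n <= c ->
  c < block_count B n -> exists x, [/\ in_block n x, A x & B x].
Proof.
move=> leA ltB; suff /block_count_gt0[x nx [Ax Bx]] : 0 < block_count (A `&` B) n.
  by exists x.
rewrite lt0n; apply/eqP => AB0; move: ltB; rewrite ltnNge => /negP; apply.
apply: leq_trans leA; rewrite -[leqRHS]addn0 -AB0.
apply: leq_trans (block_countU _ _ _); apply: block_countS => x _ Bx.
by have [Ax|nAx] := EM (A x); [right|left].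
Qed.

(** The colours are the points of earlier blocks; the length of a block is chosen
    for this lemma. *)
Lemma block_pigeonhole (A : set nat) (C : nat -> set nat) n :
  block_count (~` A) n <= n * 2 ^ block_start n ->
  (forall x, in_block n x -> A x -> exists2 y, y < block_start n & C y x) ->
  exists2 y, y < block_start n & n * 2 ^ block_start n < block_count (C y) n.
Proof.
move=> leA covA; apply: contrapT => noC.
have leC y : y < block_start n -> block_count (C y) n <= n * 2 ^ block_start n.
  by move=> lt_y; rewrite leqNgt; apply/negP => ltC; apply: noC; exists y.
suff : block_count setT n <= (block_start n).+1 * (n * 2 ^ block_start n).
  by rewrite block_countT ltnn.
rewrite mulSn; apply: leq_trans (leq_add leA (block_count_bigU _ _ _ _ leC)).
apply: leq_trans (block_countU _ _ _); apply: block_countS => x nx _.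
by have [Ax|nAx] := EM (A x); [right; exact: covA|left].
Qed.

Definition increasing_below b (s : seq nat) :=
  sorted ltn s && all (fun x => x < b) s.

(** A strictly increasing sequence below [b] is a subsequence of [iota 0 b], so
    there are at most [2 ^ b] of them. *)
Lemma block_count_guesses (g : seq nat -> nat) n :
  block_count [set z | exists2 s, increasing_below (block_start n) s & z = g s] n
    <= 2 ^ block_start n.
Proof.
set b := block_start n.
have -> : 2 ^ b = size [seq g (mask t (iota 0 b)) | t : b.-tuple bool].
  by rewrite size_map -cardE card_tuple card_bool.
rewrite /block_count -size_filter; apply: uniq_leq_size.
  exact/filter_uniq/iota_uniq.
move=> z; rewrite mem_filter => /andP[/asboolP[s /andP[srt_s lt_s] ->] _].
have -> : s = mask (map (mem s) (iota 0 b)) (iota 0 b).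
  rewrite -filter_mask; apply: (irr_sorted_eq ltn_trans ltnn) => //.
    exact/(sorted_filter ltn_trans)/iota_ltn_sorted.
  move=> x; rewrite mem_filter mem_iota add0n /=.
  by apply/idP/andP => [sx|[]//]; split=> //; exact: (allP lt_s).
have sz : size (map (mem s) (iota 0 b)) == b by rewrite size_map size_iota.
by apply/mapP; exists (Tuple sz); rewrite ?mem_enum.
Qed.

(** * The ideals of thin sets *)

Lemma thin_off_ideal P : is_ideal (thin_off P).
Proof.
split=> [A B AB [k thinB]| |A B [k thinA] [l thinB]].
- exists k => n kn nPn; apply: leq_trans (thinB n kn nPn).
  by apply: block_countS => x _; exact: AB.
- by exists 0 => n _ _; rewrite block_count0.
- exists (k + l) => n kn nPn; apply: leq_trans (block_countU _ _ _) _.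
  rewrite mulnDl leq_add ?thinA ?thinB //; lia.
Qed.

Lemma thin_off_mono P Q : almost_subset P Q -> thin_off P `<=` thin_off Q.
Proof.
move=> finPQ A [k thinA].
have [b PQb] : exists b, forall n, P n -> ~ Q n -> n < b.
  have /finite_seqP[s PQs] := finPQ.
  exists (\max_(n <- s) n).+1 => n Pn nQn; rewrite ltnS.
  have : [set` s] n by rewrite -PQs.
  by move=> /= ns; rewrite (big_rem n ns) /= leq_maxl.
exists (k + b) => n kn nQn; apply: leq_trans (_ : k * 2 ^ block_start n <= _).
  apply: thinA; first lia.
  by move=> /PQb/(_ nQn); lia.
by rewrite leq_mul2r; lia.
Qed.

Lemma gamified_ideal_le_mono (H H' I I' : set (set nat)) :
  H' `<=` H -> I `<=` I' -> gamified_ideal_le H I -> gamified_ideal_le H' I'.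
Proof.
move=> HH II [Phi cPhi leP]; exists Phi => // A /HH/leP[T [treeT brT TA]].
by exists T; split=> // s /brT; exact: II.
Qed.

(** The reduction that answers its first input entry: trees branch freely except
    at the root. *)
Lemma gamified_ideal_le_subset (H I : set (set nat)) :
  is_ideal I -> H `<=` I -> gamified_ideal_le H I.
Proof.
move=> [_ I0 _] HI; exists (fun p => Some (p 0)).
  exists (fun s => ohead s).
    by case=> [|x s] [|y t] a b //= /andP[/eqP <- _] [<-] [<-].
  by move=> p c; split=> [[<-]|[[|n]]//]; exists 1.
move=> A HA; exists [set s | if ohead s is Some x then A x else True].
split; first by split=> // -[|x s] // [|y t] //= /andP[/eqP <-].
  case=> [|x s] /= As; first exact: HI.
  rewrite /dual_upper/=; suff -> : ~` [set _ : nat | A x] = set0 by [].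
  by rewrite -subset0 => n /=; exact.
by move=> p /(_ 1) /= Ap; exists (p 0).
Qed.

(** * Positions that force an answer *)

Lemma prolong_path (Q : seq nat -> Prop) s :
    Q s -> (forall t, Q t -> exists x, Q (rcons t x)) ->
  exists2 p, mkseq p (size s) = s & forall n, size s <= n -> Q (mkseq p n).
Proof.
move=> Qs extQ.
have [f Qf] : exists f, forall t, Q t -> Q (rcons t (f t)).
  exists (fun t => xget 0 [set x | Q (rcons t x)]) => t /extQ; exact: xgetPex.
pose g n := iter n (fun t => rcons t (f t)) s.
have Qg n : Q (g n) by elim: n => //= n /Qf.
have szg n : size (g n) = size s + n.
  by elim: n => [|n IH]; rewrite ?addn0 //= size_rcons IH addnS.
have nthg m n i : i < size (g m) -> nth 0 (g (n + m)) i = nth 0 (g m) i.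
  move=> lt_i; elim: n => // n IH; rewrite addSn /= nth_rcons IH.
  by rewrite (leq_trans lt_i) // !szg leq_add2l leq_addl.
exists (fun i => nth 0 (g i.+1) i) => [|n le_n].
  apply: (@eq_from_nth _ 0); rewrite size_mkseq // => i lt_i.
  by rewrite nth_mkseq // -[i.+1]addn0 nthg.
suff -> : mkseq (fun i => nth 0 (g i.+1) i) n = g (n - size s) by [].
apply: (@eq_from_nth _ 0); rewrite size_mkseq ?szg ?subnKC // => i lt_i.
rewrite nth_mkseq //; have lt1 : i < size (g i.+1) by rewrite szg; lia.
have lt2 : i < size (g (n - size s)) by rewrite szg; lia.
by rewrite -(nthg _ (n - size s) _ lt1) addnC nthg.
Qed.

Lemma sorted_ltn_rcons s x :
  sorted ltn s -> all (fun z => z < x) s -> sorted ltn (rcons s x).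
Proof.
by rewrite !(sorted_pairwise ltn_trans) pairwise_rcons => -> lt_s; rewrite andbT.
Qed.

(** A sufficient condition, in a form suited to induction, for every tree through
    [s] that branches in the dual of [I] to have a path with answer [y]. *)
Inductive forces (I : set (set nat)) (phi : seq nat -> option nat) (y : nat) :
    seq nat -> Prop :=
  | forces_now s : phi s = Some y -> forces I phi y s
  | forces_later s (X : set nat) : ~ I X ->
      (forall x, X x -> forces I phi y (rcons s x)) -> forces I phi y s.

Lemma dual_upper_meet (I : set (set nat)) (B X : set nat) :
  lower_set I -> dual_upper I B -> ~ I X -> exists2 x, B x & X x.
Proof.
move=> lowI IB nIX; apply: contrapT => noBX; apply/nIX/lowI/IB => x Xx Bx.
by apply: noBX; exists x.
Qed.

(** A set of children in the dual of [I] meets every set outside [I], so the tree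
    can be followed along the derivation of [forces]; once [phi] has answered, any
    path of the tree will do. *)
Lemma forces_body (I : set (set nat)) phi Phi y T s :
    lower_set I -> ~ I setT ->
    (forall p c, Phi p = Some c <-> exists n, phi (mkseq p n) = Some c) ->
    is_tree T -> branching (dual_upper I) T -> T s -> forces I phi y s ->
  exists2 p, body T p & Phi p = Some y.
Proof.
move=> lowI nIT defPhi [_ clT] brT Ts Fs.
elim: Fs Ts => {s}[s phi_s|s X nIX _ IH] Ts.
  have extT t : T t -> exists x, T (rcons t x).
    by move=> /brT BT; have [x] := dual_upper_meet _ _ _ lowI BT nIT; exists x.
  have [p ps Tp] := prolong_path T s Ts extT.
  exists p; last by apply/defPhi; exists (size s); rewrite ps.
  move=> n; have [/Tp//|/ltnW le_n] := leqP (size s) n.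
  apply: clT Ts; rewrite -ps prefixE size_mkseq; apply/eqP.
  by rewrite /mkseq -map_take take_iota (minn_idPl _).
have [x Tx Xx] := dual_upper_meet _ _ _ lowI (brT s Ts) nIX.
exact: IH Xx Tx.
Qed.

Lemma thin_off_proper P : (forall k, exists2 n, k <= n & ~ P n) ->
  ~ thin_off P setT.
Proof.
move=> infP [k thinT]; have [n kn nPn] := infP k.
have := thinT n kn nPn; rewrite block_countT.
have : k * 2 ^ block_start n <= n * 2 ^ block_start n.
  by rewrite leq_mul2r kn orbT.
by rewrite mulSn; lia.
Qed.

(** * The separation theorem *)

(** Blocks in [E] are the only ones where trees are constrained and the only ones
    where answers are not.  The set [Z] of answers to be ruled out consists of
    the blocks in [E] and of two guesses for each position and each other block;
    a position of a tree avoiding [Z] that forces nothing then has a child that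
    forces nothing. *)
Lemma thin_off_not_le_setC (E : set nat) : (forall k, exists2 n, k <= n & E n) ->
  ~ gamified_ideal_le (thin_off E) (thin_off (~` E)).
Proof.
move=> infE [Phi [phi _ defPhi] leE].
set I := thin_off (~` E) in leE.
have lowI : lower_set I by have [] := thin_off_ideal (~` E).
have nIT : ~ I setT.
  by apply: thin_off_proper => k; have [n kn En] := infE k; exists n => //; apply.
pose F := forces I phi.
pose big s m y n := [/\ E n, m < n &
  n * 2 ^ block_start n < block_count [set x | F y (rcons s x)] n].
(* The two guesses for [s] and [m]; 0 when there is nothing to guess. *)
pose y1 s m := xget 0 [set y | in_block m y /\ F y s].
pose y2 s m := xget 0 [set y | in_block m y /\ exists n, big s m y n].
pose Z := [set z | exists2 m, in_block m z & E m \/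
  exists2 s, increasing_below (block_start m) s & z = y1 s m \/ z = y2 s m].
have y1Z s m y : in_block m y -> increasing_below (block_start m) s -> F y s ->
    exists2 z, Z z & F z s.
  move=> my incs Fy; have [my' Fy'] : in_block m (y1 s m) /\ F (y1 s m) s.
    by apply: (@xgetPex _ 0 [set y | in_block m y /\ F y s]); exists y.
  by exists (y1 s m) => //; exists m => //; right; exists s => //; left.
have y2Z s m y n : in_block m y -> increasing_below (block_start m) s ->
    big s m y n -> exists2 z, Z z & exists n, big s m z n.
  move=> my incs bigy.
  have [my' Fy'] : in_block m (y2 s m) /\ exists n, big s m (y2 s m) n.
    apply: (@xgetPex _ 0 [set y | in_block m y /\ exists n, big s m y n]).
    by exists y; split=> //; exists n.
  by exists (y2 s m) => //; exists m => //; right; exists s => //; right.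
have thinZ : thin_off E Z.
  exists 2 => n _ nEn; rewrite mul2n -addnn.
  apply: leq_trans (leq_add (block_count_guesses (y1 ^~ n) n)
                            (block_count_guesses (y2 ^~ n) n)).
  apply: leq_trans (block_countU _ _ _); apply: block_countS => x nx [m mx].
  have <- := in_block_inj _ _ _ nx mx.
  by case=> [//|[s incs [] ->]]; [left|right]; exists s.
have [|T [treeT brT TZ]] := leE (~` Z); first by rewrite /dual_upper/= setCK.
(* The tree [T] avoids [Z], so no position of [T] forces an element of [Z]. *)
have notZ s y : T s -> F y s -> ~ Z y.
  move=> Ts Fs Zy.
  have [p Tp Phip] := forces_body _ _ _ _ _ _ lowI nIT defPhi treeT brT Ts Fs.
  by have [c] := TZ p Tp; rewrite Phip => -[<-].
(* Positions that force nothing; increasing ones, so that [Z] has guesses for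
   them in all later blocks. *)
pose free s := [/\ T s, sorted ltn s & forall y, ~ F y s].
have free0 : free [::].
  have T0 : T [::] by case: treeT.
  split=> // y Fy; have [m my] := in_block_ex y.
  have [//|z Zz Fz] := y1Z [::] m y my _ Fy.
  exact: notZ Fz Zz.
have freeS s : free s -> exists x, free (rcons s x).
  move=> [Ts srts nFs]; apply: contrapT => stuck.
  set B := [set x | T (rcons s x)].
  have [k thinB] : I (~` B) := brT s Ts.
  have [b sb] : exists b, all (fun x => x < b) s.
    exists (\max_(x <- s) x).+1; apply/allP => x xs.
    by rewrite ltnS (big_rem x xs) leq_maxl.
  pose k' := maxn k b.
  (* The own block is excluded because it lies in [Z], later blocks because
     there [Z] has a guess that the child forces. *)
  have early n x y : E n -> k' <= n -> in_block n x -> B x -> F y (rcons s x) ->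
      y < block_start n.
    move=> En kn nx Bx Fy; rewrite ltnNge; apply/negP => le_y.
    have [m my] := in_block_ex y.
    have incx : increasing_below (block_start n.+1) (rcons s x).
      have /andP[le_x lt_x] := nx.
      have lt_s : all (fun z => z < x) s.
        apply: sub_all sb => z /leq_trans; apply.
        by apply: leq_trans le_x; apply: leq_trans (leq_block_startn n); lia.
      rewrite /increasing_below all_rcons lt_x.
      rewrite (sorted_ltn_rcons _ _ srts lt_s) /=.
      by apply: sub_all lt_s => z /ltn_trans; apply.
    have [lt_mn|lt_nm|eq_mn] := ltngtP m n.
    - case/andP: my => _; rewrite ltnNge => /negP; apply.
      exact: leq_trans (leq_block_start _ _ lt_mn) le_y.
    - have [|z Zz Fz] := y1Z (rcons s x) m y my _ Fy.
        move: incx => /andP[srt lt]; rewrite /increasing_below srt /=.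
        apply: sub_all lt => z /leq_trans; apply; exact: leq_block_start.
      exact: (notZ _ _ Bx Fz).
    - by apply: (notZ _ _ Bx Fy); exists m => //; left; rewrite eq_mn.
  have forced n x : E n -> k' <= n -> in_block n x -> B x ->
      exists2 y, y < block_start n & F y (rcons s x).
    move=> En kn nx Bx; have [[y Fy]|nF] := EM (exists y, F y (rcons s x)).
      by exists y => //; exact: early En kn nx Bx Fy.
    exfalso; apply: stuck; exists x; split=> // [|y Fy]; last by apply: nF; exists y.
    apply: sorted_ltn_rcons srts _; apply: sub_all sb => z /leq_trans; apply.
    have /andP[le_x _] := nx; apply: leq_trans le_x.
    by apply: leq_trans (leq_block_startn n); lia.
  have thinBn n : E n -> k' <= n -> block_count (~` B) n <= n * 2 ^ block_start n.
    move=> En kn; apply: leq_trans (thinB n _ _) _; [lia|by apply|].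
    by rewrite leq_mul2r; lia.
  pose C y := [set x | F y (rcons s x)].
  have popular n : E n -> k' <= n -> exists2 y, y < block_start n &
      n * 2 ^ block_start n < block_count (C y) n.
    move=> En kn; apply: (block_pigeonhole B); first exact: thinBn.
    by move=> x; exact: forced.
  (* An answer forced by many children in infinitely many blocks would be forced
     by [s]; so the finitely many answers before the block of index [k'] are not
     popular from some index on. *)
  have [M popM] : exists M, forall y n, y < block_start k' -> E n ->
      n * 2 ^ block_start n < block_count (C y) n -> n < M.
    have CI y : I (C y).
      by apply: contrapT => nIC; apply: (nFs y); exact: forces_later nIC _.
    have bdd a : exists M, forall y n, y < a -> E n ->
        n * 2 ^ block_start n < block_count (C y) n -> n < M.
      elim: a => [|a [M popM]]; first by exists 0.
      have [l thinC] := CI a; exists (maxn M l) => y n.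
      rewrite ltnS leq_eqVlt => /predU1P[->|lt_y] En lt_n; last first.
        by rewrite leq_max (popM y).
      rewrite leq_max; apply/orP; right; rewrite ltnNge; apply/negP => ln.
      have := leq_trans lt_n (thinC n ln (fun nEn => nEn En)).
      by rewrite ltn_mul2r => /andP[_]; rewrite ltnNge ln.
    exact: bdd.
  have [n] := infE (maxn M k'); rewrite geq_max => /andP[Mn kn] En.
  have [y lt_y big_y] := popular n En kn.
  have le_y : block_start k' <= y.
    rewrite leqNgt; apply/negP => /popM/(_ En big_y).
    by rewrite ltnNge Mn.
  have [m my] := in_block_ex y.
  have km : k' <= m.
    rewrite leqNgt; apply/negP => mk; case/andP: my => _.
    by rewrite ltnNge (leq_trans (leq_block_start _ _ mk) le_y).
  have mn : m < n.
    rewrite ltnNge; apply/negP => nm; case/andP: my => le_my _.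
    by move: lt_y; rewrite ltnNge (leq_trans (leq_block_start _ _ nm) le_my).
  (* The popular [y] lies in a block [m >= k'], so [Z] contains a guess [z]
     for it; [z] may be popular in another block [n'], but [n' > m >= k'] is
     still far enough for [B] to be co-thin there. *)
  have [|//|z Zz [n' [En' mn' big_z]]] := y2Z s m y n my.
    rewrite /increasing_below srts /=; apply: sub_all sb => x /leq_trans; apply.
    by apply: leq_trans (leq_block_startn m); lia.
  have [|x [nx Bx Fx]] := block_meet _ _ _ _ (thinBn n' En' _) big_z; first lia.
  exact: (notZ _ _ Bx Fx).
have [p _ freep] := prolong_path free [::] free0 freeS.
have [|c Phic _] := TZ p; first by move=> n; have [] := freep n (leq0n _).
have /defPhi[n phic] := Phic.
have [_ _ nF] := freep n (leq0n _).
exact: (nF c) (forces_now _ _ _ _ phic).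
Qed.

Lemma gamified_thin_offP P Q :
  gamified_ideal_le (thin_off P) (thin_off Q) <-> almost_subset P Q.
Proof.
split=> [lePQ|/thin_off_mono PQ]; last first.
  exact: gamified_ideal_le_subset (thin_off_ideal Q) PQ.
apply: contrapT => infPQ; pose E := P `\` Q.
have infE k : exists2 n, k <= n & E n.
  apply: contrapT => noE; apply: infPQ.
  apply: (@sub_finite_set _ _ `I_k) (finite_II k) => n En /=.
  by rewrite ltnNge; apply/negP => kn; apply: noE; exists n.
apply: (thin_off_not_le_setC E infE); move: lePQ.
apply: gamified_ideal_le_mono; apply: thin_off_mono.
  by apply: sub_finite_set (finite_set0 nat) => n [[Pn _] /(_ Pn)].
by apply: sub_finite_set (finite_set0 nat) => n [Qn /contrapT[_]].
Qed.

(** * Well-orders and the bounding number *)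

Section WellOrder.
Context (W : Type) (R : rel W) (woR : well_order R).

Definition segment x : set W := [set y | R y x /\ y <> x].

Lemma well_order_min (P : set W) x : P x -> exists2 z, P z & forall y, P y -> R z y.
Proof.
move=> Px; have [|z [[/asboolP Pz lbz] _]] := woR (fun x => `[< P x >]).
  by exists x; apply/asboolP.
by exists z => // y Py; apply: lbz; apply/asboolP.
Qed.

Lemma well_order_refl x : R x x.
Proof. by have [|z -> ->] := well_order_min [set x] x. Qed.

Lemma well_order_anti x y : R x y -> R y x -> x = y.
Proof.
move=> Rxy Ryx; pose A := fun z => `[< z = x \/ z = y >].
have [|z [_ uniq_z]] := woR A; first by exists x; apply/asboolP; left.
have minA t : R t x -> R t y -> A t -> minimum_of R A t.
  by move=> Rtx Rty At; split=> // r /asboolP[] ->.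
transitivity z; first apply/esym; apply/uniq_z/minA => //.
- exact: well_order_refl.
- by apply/asboolP; left.
- exact: well_order_refl.
- by apply/asboolP; right.
Qed.

Lemma well_order_total x y : R x y \/ R y x.
Proof.
have [|z [->|->] lb] := well_order_min [set z | z = x \/ z = y] x; first by left.
  by left; apply: lb; right.
by right; apply: lb; left.
Qed.

Lemma well_order_wf : well_founded (fun y x => segment x y).
Proof.
move=> x; apply: contrapT => nAx.
have [z nAz lbz] := well_order_min [set x | ~ Acc (fun y x => segment x y) x] x nAx.
apply: nAz; split=> y [Ryz neq_yz]; apply: contrapT => nAy.
exact/neq_yz/well_order_anti/lbz.
Qed.

(** Transfinite recursion where only the set of earlier values matters; that set
    is no larger than the segment of earlier indices. *)
Lemma well_order_rec (V : Type) (good : set V -> V -> Prop) :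
    (forall x (X : set V), X #<= segment x -> exists v, good X v) ->
  exists f : W -> V, forall x, good (f @` segment x) (f x).
Proof.
move=> goodP; have [[x0 _]|noW] := EM (exists x : W, True); last first.
  have noW' (x : W) : False by apply: noW; exists x.
  by exists (fun x => False_rect V (noW' x)) => x; case: (noW' x).
have [v0 _] := goodP x0 set0 (card_ge0 _ _).
have [|pick pickP] :=
    @choice _ _ (fun X v => (exists v, good X v) -> good X v).
  move=> X.
  have [[v gv]|ngX] := EM (exists v, good X v); first by exists v.
  by exists v0 => /ngX.
pose step x (rec : forall y, segment x y -> V) :=
  pick [set v | exists y (yx : segment x y), rec y yx = v].
pose f := Fix well_order_wf (fun=> V) step.
have fE x : f x = pick (f @` segment x).
  rewrite /f Fix_eq => [|y g h gh].
    congr pick; apply/seteqP; split=> [v [y [yx <-]]|v [y yx <-]]; first by exists y.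
    by exists y, yx.
  congr pick; apply/seteqP; split=> v [z [zy <-]]; exists z, zy; by rewrite gh.
exists f => x; rewrite [X in good _ X]fE; apply: pickP.
exact/(goodP x)/card_image_le.
Qed.

End WellOrder.

Lemma inj_on_card_le (T U : Type) (A : set T) (B : set U) (f : T -> U) :
  set_fun A B f -> set_inj A f -> A #<= B.
Proof.
move=> AB injf; have [g] : $|{injfun A >-> B}| by apply/injfunPex; exists f.
exact: inj_card_le g.
Qed.

Lemma unboundedT : unbounded_family setT.
Proof.
move=> [g /(_ (fun n => (g n).+1) I)[N /(_ N (leqnn N))]].
by rewrite ltnn.
Qed.

(** Well-order all functions and keep those [t] whose initial segment is smaller
    than every unbounded family.  The functions kept are at least as many as some
    unbounded family, by the choice of the first [t] not kept (or because all are
    kept), and they inject into each unbounded family by transfinite recursion. *)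
Lemma order_type_b_exists : exists (W : Type) (R : rel W), order_type_b R.
Proof.
have [R0 woR0] := well_ordering_principle (nat -> nat).
pose D := [set t | forall F : set (nat -> nat),
  F #<= segment _ R0 t -> ~ unbounded_family F].
pose R : rel (set_type D) := fun x y => R0 (val x) (val y).
have woR : well_order R.
  apply: antisymmetric_well_order => [x y /andP[Rxy Ryx]|A [x Ax]].
    exact/val_inj/(well_order_anti _ _ woR0).
  have [|_ [z Az <-] lbz] :=
    well_order_min _ _ woR0 (val @` [set x | x \in A]) (val x); first by exists x.
  by exists z; split=> // y Ay; apply: lbz; exists y.
have smallR x (F : set (nat -> nat)) : F #<= segment _ R x -> ~ unbounded_family F.
  move=> leF; have /set_mem Dx := valP x; apply: Dx.
  apply: card_le_trans leF _.
  apply: (@inj_on_card_le _ _ _ _ val) => [y [Ryx neq]|? ? _ _]; last exact: val_inj.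
  by split=> // /val_inj.
have leD F : unbounded_family F -> [set: set_type D] #<= F.
  move=> ubF.
  have [x X leX|f good_f] :=
      well_order_rec _ _ woR _ (fun X v => F v /\ ~ X v).
    apply: contrapT => noV; apply: (smallR x F) ubF.
    apply: card_le_trans leX; apply: subset_card_le => v Fv.
    by apply: contrapT => nXv; apply: noV; exists v.
  apply: (@inj_on_card_le _ _ _ _ f) => [x _|x y _ _ fxy]; first by case: (good_f x).
  apply: contrapT => neq_xy; have [Rxy|Ryx] := well_order_total _ _ woR x y.
    by case: (good_f y) => _; apply; exists x.
  by case: (good_f x) => _; apply; exists y => //; split=> // /esym.
exists (set_type D), R.
have [F ubF leF] : exists2 F, unbounded_family F & F #<= [set: set_type D].
  have DE : D = val @` [set: set_type D].
    apply/seteqP; split=> [t /mem_set Dt|_ [x _ <-]].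
      by exists (SigSub Dt).
    by have /set_mem := valP x.
  suff [F ubF leF] : exists2 F, unbounded_family F & F #<= D.
    exists F => //; apply: card_le_trans leF _.
    by rewrite [X in X #<= _]DE; exact: card_image_le.
  have [[t nDt]|DT] := EM (exists t, ~ D t); last first.
    exists setT; first exact: unboundedT.
    apply: subset_card_le => t _; apply: contrapT => nDt; apply: DT.
    by exists t.
  have [s nDs lb_s] := well_order_min _ _ woR0 (~` D) t nDt.
  have /existsNP[F /not_implyP[leF /contrapT ubF]] := nDs.
  exists F => //; apply: card_le_trans leF _; apply: subset_card_le => r [Rrs neq].
  by apply: contrapT => /lb_s Rsr; apply: neq; exact: (well_order_anti _ _ woR0).
split=> //.
  by split=> //; exists F => //; apply/card_eqPle; split=> //; exact: leD.
move=> x; apply/negP => leT.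
by apply: (smallR x F) ubF; exact: card_le_trans leT.
Qed.

Lemma eventually_le_refl f : eventually_le f f.
Proof. by exists 0. Qed.

(** At stage [x] the earlier functions are fewer than [b], hence bounded by some
    [g], and [g + 1] is strictly above all of them. *)
Lemma scale_b (W : Type) (R : rel W) : order_type_b R ->
  exists f : W -> nat -> nat, forall x y, R x y <-> eventually_le (f x) (f y).
Proof.
move=> [woR [_ leW] smallR].
have [x X leX|f good_f] := well_order_rec _ _ woR (nat -> nat)
    (fun X v => forall u, X u -> eventually_le u v /\ ~ eventually_le v u).
  have [g gP] : exists g, forall u, X u -> eventually_le u g.
    apply: contrapT => /leW leWX; have := smallR x.
    by rewrite (card_le_trans leWX leX).
  exists (fun n => (g n).+1) => u /gP[N leN]; split.
    by exists N => n /leN; exact: leqW.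
  move=> [M leM]; have := leM (maxn M N) (leq_maxl _ _).
  by rewrite ltnNge leN // leq_maxr.
exists f => x y; split=> [Rxy|].
  have [->|neq] := EM (x = y); first exact: eventually_le_refl.
  by have [|//] := good_f y (f x); exists x.
apply: contraPP => nRxy.
have [//|Ryx] := well_order_total _ _ woR x y.
have [|//] := good_f x (f y); exists y => //; split=> // eq_yx.
by apply: nRxy; rewrite eq_yx; exact: well_order_refl.
Qed.

(** * Chains and almost disjoint families modulo finite sets *)

Definition subgraph (f : nat -> nat) : set nat :=
  [set z | exists i, exists2 j, j <= f i & z = pickle (i, j)].

Lemma subgraph_almost_subset f g :
  almost_subset (subgraph f) (subgraph g) <-> eventually_le f g.
Proof.
split=> [fin_fg|[N leN]].
  have /finite_seqP[s sP] := fin_fg.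
  pose fst_of (z : nat) :=
    if unpickle z : option (nat * nat) is Some ij then ij.1 else 0.
  exists (\max_(z <- s) fst_of z).+1 => i; rewrite leqNgt => lt_i.
  rewrite leqNgt; apply/negP => gf.
  have : [set` s] (pickle (i, f i)).
    rewrite -sP; split; first by exists i, (f i).
    move=> [i' [j le_j /(pcan_inj pickleK)[eq_i eq_j]]].
    by move: gf; rewrite eq_j eq_i ltnNge le_j.
  move=> /= zs; apply: (negP lt_i); rewrite ltnS (big_rem _ zs) /=.
  by rewrite {1}/fst_of pickleK leq_maxl.
pose M := \max_(i < N) f i.
apply: (@sub_finite_set _ _ (pickle @` (`I_N `*` `I_M.+1))).
  move=> _ [[i [j le_j ->]] ngz]; exists (i, j) => //=.
  have lt_i : i < N.
    rewrite ltnNge; apply/negP => /leN le_fg; apply: ngz; exists i, j => //.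
    exact: leq_trans le_fg.
  by split=> //; rewrite /= ltnS (leq_trans le_j) // (leq_bigmax (Ordinal lt_i)).
by apply: finite_image; apply: finite_setX; exact: finite_II.
Qed.

(** The branch of the binary tree given by the characteristic function of [B];
    two branches share only the nodes before the point where they split. *)
Definition branch (B : set nat) : set nat :=
  [set pickle (mkseq (fun i => `[< B i >]) n) | n in [set: nat]].

Lemma branch_almost_subset A B : almost_subset (branch A) (branch B) -> A = B.
Proof.
apply: contraPP => neqAB finAB.
have [i neq_i] : exists i, `[< A i >] <> `[< B i >].
  apply: contrapT => eqAB; apply: neqAB.
  have eqb i : `[< A i >] = `[< B i >].
    by apply: contrapT => neq_i; apply: eqAB; exists i.
  by apply/seteqP; split=> i /asboolP; [rewrite eqb | rewrite -eqb] => /asboolP.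
pose code n := pickle (mkseq (fun i => `[< A i >]) n).
have inj_code : injective code.
  move=> m n /(pcan_inj pickleK)/(congr1 size).
  by rewrite !size_mkseq.
apply: infinite_nat; apply: (card_le_finite _ finAB).
apply: (@inj_on_card_le _ _ _ _ (fun n => code (i.+1 + n))).
  move=> n _; split; first by exists (i.+1 + n).
  move=> [m _ /(pcan_inj pickleK) eq_m].
  have sz := congr1 size eq_m; rewrite !size_mkseq in sz.
  have := congr1 (nth false ^~ i) eq_m; rewrite sz !nth_mkseq ?leq_addr //.
  by move=> /esym.
by move=> m n _ _ /inj_code/addnI.
Qed.

Theorem theoremA :
  [/\ (exists I : powerset_mod_fin -> set (set nat),
         (forall x, is_ideal (I x)) /\
         (forall P Q : set nat, almost_subset P Q <->
            gamified_ideal_le (I (fin_class P)) (I (fin_class Q)))),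
      (exists (W : Type) (R : rel W) (c : W -> set (set nat)),
         [/\ order_type_b R,
             (forall x, is_ideal (c x)) &
             (forall x y, R x y <-> gamified_ideal_le (c x) (c y))]) &
      (exists F : set (set (set nat)),
         [/\ (forall H, F H -> is_ideal H),
             F #= [set: set nat] &
             (forall H J, F H -> F J -> H <> J ->
                ~ gamified_ideal_le H J /\ ~ gamified_ideal_le J H)])].
Proof.
split.
- have repr_class P :
      almost_subset P (repr (fin_class P)) /\ almost_subset (repr (fin_class P)) P.
    have : fin_eqv P (repr (fin_class P)) by apply/eqmodP; rewrite reprK.
    by move/asboolP.
  exists (fun x => thin_off (repr x)); split=> [x|P Q].
    exact: thin_off_ideal.
  have [[PrP rPP] [QrQ rQQ]] := (repr_class P, repr_class Q).
  split=> [PQ|/gamified_thin_offP rPrQ].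
    apply/gamified_thin_offP/(almost_subset_trans rPP).
    exact: almost_subset_trans PQ QrQ.
  exact: almost_subset_trans PrP (almost_subset_trans rPrQ rQQ).
- have [W [R bR]] := order_type_b_exists; have [f fP] := scale_b W R bR.
  exists W, R, (fun x => thin_off (subgraph (f x))); split=> // [x|x y].
    exact: thin_off_ideal.
  by rewrite fP -subgraph_almost_subset gamified_thin_offP.
- pose c B := thin_off (branch B).
  have le_c A B : gamified_ideal_le (c A) (c B) -> A = B.
    by move=> /gamified_thin_offP; exact: branch_almost_subset.
  exists (c @` setT); split=> [_ [B _ <-]| |_ _ [A _ <-] [B _ <-] neq_c].
  + exact: thin_off_ideal.
  + apply: inj_card_eq => A B _ _ eq_c; apply: le_c; rewrite eq_c.
    exact: gamified_ideal_le_subset (thin_off_ideal _) _.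
  + by split=> /le_c eqAB; apply: neq_c; rewrite eqAB.
Qed.
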